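(* Let $z\in(0,1-1/\sqrt2)$, let $\tau,\gamma$ be positive numbers and let $\{\Delta_m,\ m\in\mathcal M\}$ be nonnegative numbers such that $\Sigma=\sum_{m\in\mathcal M}e^{-\Delta_m}<+\infty$ and $\Delta_m\ge 1$ for all $m\in\mathcal M$. Assume that there are positive numbers $\{d_m,\ m\in\mathcal M\}$ such that for all $(m,m')\in\mathcal M^2$, all $\xi>0$ and all $y>0$ with $y^2\ge\tau(d_m\vee d_{m'}+\xi)$, $$\mathbb P\left[\sup_{(t,t')\in S_m\times S_{m'}}\frac{Z(N,t,t')}{w^2(t,t',y)}\ge z\right]\le\gamma e^{-\xi}.$$ Let $\mathrm{pen}:\mathbb S\to\mathbb R_+$ satisfy $$\mathrm{pen}(t)\ge z\tau\inf\{d_m+\Delta_m,\ m\in\mathcal M(t)\}\quad\text{for all }t\in\mathbb S,$$ and let $\tilde s=\hat s_{\hat\lambda}$ be selected among $\{\hat s_\lambda,\ \lambda\in\Lambda\}$ by the selection procedure (described in the context) with this penalty and this $\tau$. Then, for all $\xi>0$, $$\mathbb P\left[H^2(s,\tilde s)\ge C_1\inf_{\lambda\in\Lambda}\left[H^2(s,\hat s_\lambda)+\mathrm{pen}(\hat s_\lambda)\right]+C_2\tau\xi\right]\le(\gamma\Sigma^2e^{-\xi})\wedge1,$$ where, with $\kappa=z+1/\sqrt2$ and $\alpha=(1+\kappa)/(1-\kappa)$, $$C_1=(2+\sqrt\alpha)\max\left\{2+\sqrt\alpha,\ \frac{2}{\sqrt{1-\kappa^2}}+\frac{1}{z(1+\sqrt\alpha)}\right\},\qquad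 C_2=\frac{z(2+\sqrt\alpha)}{\sqrt{1-\kappa^2}}.$$
   Context: Setting. $N_1,\dots,N_k$ are independent random measures on a probability space $(\Omega,\mathcal T,\mathbb P)$, $N_i$ taking values in the positive measures on a measured space $(\mathcal X_i,\mathcal A_i,\mu_i)$, with $\mathbb E[N_i(A)]=\int_A s_i\,d\mu_i<+\infty$ for all $A\in\mathcal A_i$, where $s_i\ge0$ is measurable. Write $N=(N_1,\dots,N_k)$, $s=(s_1,\dots,s_k)$, $\mu=(\mu_1,\dots,\mu_k)$. $\mathcal L$ is the set of $k$-tuples $t=(t_1,\dots,t_k)$ of nonnegative measurable functions with $t_i$ integrable on $(\mathcal X_i,\mathcal A_i,\mu_i)$; $\mathcal L_0\subset\mathcal L$ is a known subset containing $s$. All operations on $k$-tuples are componentwise, and $\int_{\mathcal X}f\,d\nu=\sum_{i=1}^k\int_{\mathcal X_i}f_i\,d\nu_i$ for $k$-tuples $f$ of functions and $\nu$ of measures. The loss is $H^2(t,t')=\frac12\int_{\mathcal X}(\sqrt t-\sqrt{t'})^2d\mu$. Notation. For $t,t'\in\mathcal L_0$: $\rho(t,t')=\int_{\mathcal X}\sqrt{tt'}\,d\mu$, and $\rho_r(\nu,t)=\frac12\left[\rho(t,r)+\int_{\mathcal X}\sqrt{t/r}\,d\nu\right]$ (conventions $0/0=0$, $a/0=+\infty$ for $a>0$). $Z(N,t,t')=\int_{\mathcal X}\psi(t,t',x)\,dN-\int_{\mathcal X}\psi(t,t',x)\,s\,d\mu$, where (componentwise) $\psi(t,t',x)=\frac1{\sqrt2}\left[\sqrt{\frac1{1+t(x)/t'(x)}}-\sqrt{\frac1{1+t'(x)/t(x)}}\right]$.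 For $y>0$, $w^2(t,t',y)=[H^2(s,t)+H^2(s,t')]\vee y^2$. Models and estimators. $\{S_m,\ m\in\mathcal M\}$ is an at most countable family of nonvoid subsets of $\mathcal L_0$, $\mathbb S=\bigcup_{m}S_m$, and $\mathcal M(t)=\{m\in\mathcal M:\ t\in S_m\}$ for $t\in\mathbb S$. $\{\hat s_\lambda,\lambda\in\Lambda\}$ is an at most countable family of estimators (measurable functions of $N$) with values in $\mathbb S$. Selection procedure. For $\hat s_\lambda\ne\hat s_{\lambda'}$ put, with $r=(\hat s_\lambda+\hat s_{\lambda'})/2$, $$\mathbf T(N,\hat s_\lambda,\hat s_{\lambda'})=\left[\rho_r(N,\hat s_{\lambda'})-\tfrac12\int_{\mathcal X}\hat s_{\lambda'}d\mu-\mathrm{pen}(\hat s_{\lambda'})\right]-\left[\rho_r(N,\hat s_\lambda)-\tfrac12\int_{\mathcal X}\hat s_\lambda d\mu-\mathrm{pen}(\hat s_\lambda)\right].$$ Let $\mathcal E(\hat s_\lambda)$ be the set of those $\hat s_{\lambda'}\neq \hat s_\lambda$ with $\mathbf T(N,\hat s_\lambda,\hat s_{\lambda'})\ge0$, and $\mathcal D(\hat s_\lambda)=\sup\{H^2(\hat s_\lambda,\hat s_{\lambda'}):\hat s_{\lambda'}\in\mathcal E(\hat s_\lambda)\}$ if $\mathcal E(\hat s_\lambda)\ne\varnothing$, $\mathcal D(\hat s_\lambda)=0$ otherwise. Then $\hat\lambda$ is any element of $\Lambda$ such that $\mathcal D(\hat s_{\hat\lambda})\le\mathcal D(\hat s_\lambda)+\tau$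 for all $\lambda\in\Lambda$. *)

(* Defs.v *)
From HB Require Import structures.
From mathcomp Require Import all_boot all_order all_algebra.
From mathcomp Require Import all_classical all_reals all_analysis.
From mathcomp Require Import measurable_realfun.

Set Implicit Arguments.
Unset Strict Implicit.
Unset Printing Implicit Defensive.

Import Order.TTheory GRing.Theory Num.Theory.
Import numFieldNormedType.Exports.

Local Open Scope classical_set_scope.
Local Open Scope ring_scope.
Local Open Scope ereal_scope.

Section Tuples.
Context (R : realType) (k : nat) (dX : 'I_k -> measure_display)
  (X : forall i : 'I_k, measurableType (dX i)).

Definition ftuple := forall i : 'I_k, X i -> R.
Definition eftuple := forall i : 'I_k, X i -> \bar R.
Definition mtuple := forall i : 'I_k, {measure set (X i) -> \bar R}.

Implicit Types (nu mu : mtuple) (s t r : ftuple) (f : eftuple).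

Definition integral_tuple nu f : \bar R :=
  \sum_(i < k) \int[nu i]_x f i x.

Definition calL mu : set ftuple :=
  [set t : ftuple | forall i, [/\ (forall x, (0 <= t i x)%R),
                         measurable_fun [set: X i] (t i)
                       & (mu i).-integrable [set: X i] (EFin \o t i)]].

Definition H2 mu t t' : \bar R :=
  (2^-1)%:E * integral_tuple mu
    (fun i x => ((Num.sqrt (t i x) - Num.sqrt (t' i x)) ^+ 2)%:E).

Definition rho mu t t' : \bar R :=
  integral_tuple mu (fun i x => (Num.sqrt (t i x * t' i x))%:E).

(* Quotients are taken in \bar R, where 0^-1 = +oo, +oo^-1 = 0 and 0 * +oo = 0;
   hence 0 / 0 = 0 and a / 0 = +oo for a > 0. *)
Definition rho_r mu r nu t : \bar R :=
  (2^-1)%:E * (rho mu t r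
    + integral_tuple nu (fun i x => sqrte ((t i x)%:E / (r i x)%:E))).

Definition psi t t' : eftuple := fun i x =>
  ((Num.sqrt 2)^-1)%:E *
  (sqrte (1 / (1 + (t i x)%:E / (t' i x)%:E))
   - sqrte (1 / (1 + (t' i x)%:E / (t i x)%:E))).
Arguments psi t t' i x : clear implicits.

Definition Z mu s nu t t' : \bar R :=
  integral_tuple nu (psi t t')
  - integral_tuple mu (fun i x => psi t t' i x * (s i x)%:E).

Definition w2 mu s t t' (y : R) : \bar R :=
  maxe (H2 mu s t + H2 mu s t') (y ^+ 2)%:E.

Definition mean_tuple t t' : ftuple := fun i x => ((t i x + t' i x) / 2)%R.

Definition T_crit mu (pen : ftuple -> R) nu t r : \bar R :=
  rho_r mu r nu t
  - (2^-1)%:E * integral_tuple mu (fun i x => (t i x)%:E) - (pen t)%:E.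

Definition T_stat mu (pen : ftuple -> R) nu t t' : \bar R :=
  let r := mean_tuple t t' in T_crit mu pen nu t' r - T_crit mu pen nu t r.

(* [est l] is the value taken by the estimator of index l at the observation
   [nu]. *)
Definition calE mu pen nu (Lambda : Type) (est : Lambda -> ftuple) t :
    set ftuple :=
  [set t' | [/\ range est t', t' <> t & 0 <= T_stat mu pen nu t t']].

Definition calD mu pen nu (Lambda : Type) (est : Lambda -> ftuple) t : \bar R :=
  if `[< calE mu pen nu est t !=set0 >]
  then ereal_sup [set H2 mu t t' | t' in calE mu pen nu est t]
  else 0.

(* sigma-algebra on k-tuples of measures generated by the evaluations
   nu |-> nu_i(A). *)
Definition sigma_mtuple : set (set mtuple) :=
  <<s [set E : set mtuple | exists (i : 'I_k) (A : set (X i)) (B : set (\bar R)),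
        [/\ measurable A, measurable B & E = [set nu : mtuple | B (nu i A)]]] >>.

Context (dO : measure_display) (Omega : measurableType dO).

(* sigma-algebra on Omega generated by the random measure M, i.e. by the
   variables M(A). *)
Definition sigma_rmeasure (d : measure_display) (Y : measurableType d)
    (M : R.-ker Omega ~> Y) : set (set Omega) :=
  <<s [set E : set Omega | exists (A : set Y) (B : set (\bar R)),
        [/\ measurable A, measurable B & E = [set w | B (M w A)]]] >>.

(* Each E i may be Omega, so the product rule over all k indices contains the
   rule for every subfamily. *)
Definition independent_rmeasures (P : probability Omega R)
    (N : forall i : 'I_k, R.-ker Omega ~> X i) : Prop :=
  forall E : 'I_k -> set Omega, (forall i, sigma_rmeasure (N i) (E i)) ->
    P (\bigcap_i E i) = \big[mule/1]_(i < k) P (E i).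

Definition observation (N : forall i : 'I_k, R.-ker Omega ~> X i)
    (w : Omega) : mtuple := fun i => N i w.

End Tuples.

Section Constants.
Context (R : realType).
Local Open Scope ring_scope.

Definition kappa (z : R) : R := z + 1 / Num.sqrt 2.
Definition alpha (z : R) : R := (1 + kappa z) / (1 - kappa z).
Definition C1 (z : R) : R :=
  (2 + Num.sqrt (alpha z)) *
  Num.max (2 + Num.sqrt (alpha z))
    (2 / Num.sqrt (1 - kappa z ^+ 2) + 1 / (z * (1 + Num.sqrt (alpha z)))).
Definition C2 (z : R) : R :=
  z * (2 + Num.sqrt (alpha z)) / Num.sqrt (1 - kappa z ^+ 2).

End Constants.

(* Main.v *)
Require Import Defs.
From mathcomp Require Import all_boot all_order all_algebra.
From mathcomp Require Import all_classical all_reals all_analysis.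
From mathcomp Require Import measurable_realfun ring lra.

Set Implicit Arguments.
Unset Strict Implicit.
Unset Printing Implicit Defensive.

Import Order.TTheory GRing.Theory Num.Theory.
Import numFieldNormedType.Exports.

Local Open Scope classical_set_scope.
Local Open Scope ring_scope.
Local Open Scope ereal_scope.

(** Let [t], [t'] be two values of the estimators. Replacing the observation by
    its intensity in the test statistic, at the price of the centred term
    [Z(N,t,t')], leaves an integral with respect to [mu] which is at most
    [H2(s,t) - H2(s,t') + (H2(s,t) + H2(s,t')) / sqrt 2] ([T_stat_drift]): up to
    a fraction [1 / sqrt 2] of the losses, the test compares the distances from
    [s] to [t] and to [t'].

    Suppose that, for all pairs of models at once, [Z < z w2] with
    [y^2 = tau (max (d_m, d_m') + Delta_m + Delta_m' + xi)]. As the maximum in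
    [w2] is at most the sum of its arguments, and as [pen t] dominates the infimum
    of [z tau (d_m + Delta_m)] over the models containing [t], this gives
    [Z(N,t,t') <= z (H2(s,t) + H2(s,t')) + pen t + pen t' + z tau xi] for all
    [t], [t'] ([deviation_bound_of_models]). A [t'] preferred to [t] by the test
    then satisfies
    [(1 - kappa) H2(s,t') <= (1 + kappa) H2(s,t) + 2 pen t + z tau xi].
    The inequality [(x + y)^2 <= (1 + c) x^2 + (1 + 1/c) y^2] with
    [c = sqrt alpha] turns this into a bound for [H2(t,t')], hence for
    [calD t] ([h2_preferred_le]). As the test is antisymmetric, either the
    selected estimator [stilde] is preferred to [t], and then
    [H2(t,stilde) <= calD t], or [t] is preferred to [stilde], and then
    [H2(t,stilde) <= calD stilde <= calD t + tau]. The same inequality with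
    [c = 1 + sqrt alpha], together with [tau <= pen t / z], gives the constants [C1] and [C2]
    ([selected_risk_le]).

    A union bound over the pairs of models ([mu_ext_model_pairs]) gives the
    factor [gamma Sigma^2]. The event of the theorem involves a non-strict
    inequality, while the argument shows that the risk is at most the bound off
    the bad event. Hence the argument is run at any level [xi' < xi], where the
    bad event covers the event of the theorem because [C2 > 0], and
    [xi'] then tends to [xi] ([mu_ext_exp_left_limit]). *)

(** * Pointwise inequalities *)

Section Pointwise.
Context (R : realType).
Implicit Types a b c r s x u v w : R.
Local Open Scope ring_scope.

Definition sqdist a b : R := (Num.sqrt a - Num.sqrt b) ^+ 2.

(** The value of [psi] at a point where the two functions are [a] and [b],
    written with the ratios [sqrt (a / r)] and [sqrt (b / r)] of the test
    statistic, where [r] is the mean of [a] and [b]. At [a = b = 0] both formulas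
    vanish, here because [0^-1 = 0]. *)
Definition psir a b : R :=
  2^-1 * (Num.sqrt b / Num.sqrt ((a + b) / 2) -
          Num.sqrt a / Num.sqrt ((a + b) / 2)).

Lemma sqdistC a b : sqdist a b = sqdist b a.
Proof. by rewrite /sqdist -sqrrN opprB. Qed.

Lemma sqdist_ge0 a b : 0 <= sqdist a b.
Proof. exact: sqr_ge0. Qed.

Lemma sqdist_le a b : 0 <= a -> 0 <= b -> sqdist a b <= a + b.
Proof.
move=> a0 b0; rewrite /sqdist -[in leRHS](sqr_sqrtr a0) -[in leRHS](sqr_sqrtr b0).
have := sqrtr_ge0 a; have := sqrtr_ge0 b; nra.
Qed.

(** The defect of the inequality is a square divided by [c]. It plays the role of
    the triangle inequality for the Hellinger distance, in the form that can be
    integrated. *)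
Lemma sqdist_young c s a b : 0 < c ->
  sqdist a b <= (1 + c) * sqdist s a + (1 + c^-1) * sqdist s b.
Proof.
move=> c0; rewrite /sqdist; set u := Num.sqrt a; set v := Num.sqrt b.
set S := Num.sqrt s; rewrite -subr_ge0.
suff -> : (1 + c) * (S - u) ^+ 2 + (1 + c^-1) * (S - v) ^+ 2 - (u - v) ^+ 2 =
  c^-1 * (c * (S - u) + (S - v)) ^+ 2.
  by rewrite mulr_ge0 ?sqr_ge0// invr_ge0 ltW.
by field; rewrite gt_eqF.
Qed.

Lemma sqrt_mul_le a b : 0 <= a -> 0 <= b -> Num.sqrt (a * b) <= a + b.
Proof.
move=> a0 b0; rewrite sqrtrM//.
rewrite -[in leRHS](sqr_sqrtr a0) -[in leRHS](sqr_sqrtr b0).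
have := sqrtr_ge0 a; have := sqrtr_ge0 b; nra.
Qed.

Lemma sqrt_ratio_le2 a b : 0 <= a -> 0 <= b ->
  Num.sqrt a / Num.sqrt ((a + b) / 2) <= 2.
Proof.
move=> a0 b0; have [r0|r0] := eqVneq ((a + b) / 2) 0.
  by rewrite r0 sqrtr0 invr0 mulr0.
have r_gt0 : 0 < (a + b) / 2 by rewrite lt_def r0/= divr_ge0// addr_ge0.
rewrite ler_pdivrMr ?sqrtr_gt0//.
have h : Num.sqrt a ^+ 2 <= (2 * Num.sqrt ((a + b) / 2)) ^+ 2.
  by rewrite exprMn !sqr_sqrtr// ?(ltW r_gt0)//; lra.
by rewrite -(@ler_pXn2r _ 2)// nnegrE ?mulr_ge0// ?sqrtr_ge0.
Qed.

Lemma psir_bound a b : 0 <= a -> 0 <= b -> `|psir a b| <= 1.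
Proof.
move=> a0 b0; rewrite /psir.
have := sqrt_ratio_le2 a0 b0; have := sqrt_ratio_le2 b0 a0; rewrite (addrC b a).
set x := _ / _ => hx; set y := _ / _ => hy.
have x0 : 0 <= x by rewrite /x divr_ge0// sqrtr_ge0.
have y0 : 0 <= y by rewrite /y divr_ge0// sqrtr_ge0.
rewrite ler_norml; lra.
Qed.

(** With [r] the mean of [a] and [b], the left-hand side exceeds the first
    difference on the right by
    [(sqrt b - sqrt a) / (2 sqrt r) * (sqrt s - sqrt r)^2]. The ratio
    [|sqrt b - sqrt a| / sqrt r] is at most [sqrt 2], and [(sqrt s - sqrt r)^2]
    is at most the mean of [sqdist s a] and [sqdist s b]. *)
Lemma psir_drift a b s : 0 <= a -> 0 <= b -> 0 <= s ->
  psir a b * s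
  + (2^-1 * Num.sqrt (b * ((a + b) / 2)) - 2^-1 * b)
  - (2^-1 * Num.sqrt (a * ((a + b) / 2)) - 2^-1 * a)
  <= 2^-1 * sqdist s a - 2^-1 * sqdist s b
     + (Num.sqrt 2)^-1 * (2^-1 * sqdist s a + 2^-1 * sqdist s b).
Proof.
move=> a0 b0 s0; rewrite /psir /sqdist.
have r0 : 0 <= (a + b) / 2 by lra.
have w2 := sqr_sqrtr r0; have w0 := sqrtr_ge0 ((a + b) / 2).
rewrite (sqrtrM _ b0) (sqrtrM _ a0).
have c0 : 0 <= (Num.sqrt 2)^-1 :> R by rewrite invr_ge0 sqrtr_ge0.
have c2 : (Num.sqrt 2)^-1 ^+ 2 = 2^-1 :> R by rewrite exprVn sqr_sqrtr.
have u2 := sqr_sqrtr a0; have v2 := sqr_sqrtr b0; have S2 := sqr_sqrtr s0.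
have u0 := sqrtr_ge0 a; have v0 := sqrtr_ge0 b; have t0 := sqrtr_ge0 s.
move: (Num.sqrt ((a + b) / 2)) w0 w2 => w w0 w2.
move: (Num.sqrt 2)^-1 (Num.sqrt a) (Num.sqrt b) (Num.sqrt s) c0 c2 u0 v0 t0 u2 v2 S2.
move=> c u v S c0 c2 u0 v0 t0 u2 v2 S2.
have [wE|wN] := eqVneq w 0.
  have uE : u = 0 by apply/eqP; rewrite -sqrf_eq0; apply/eqP; nra.
  have vE : v = 0 by apply/eqP; rewrite -sqrf_eq0; apply/eqP; nra.
  have aE : a = 0 by nra.
  have bE : b = 0 by nra.
  by rewrite wE uE vE aE bE invr0; nra.
have w_gt0 : 0 < w by rewrite lt_def wN.
rewrite -mulrBl; set k := (v - u) / w.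
have kw : k * w = v - u by rewrite /k divfK.
(* |v - u| <= sqrt 2 * w, since (v - u)^2 <= u^2 + v^2 = 2 w^2 *)
have k2 : k <= 2 * c.
  have k2w : k ^+ 2 <= 2.
    rewrite -(@ler_pM2r _ (w ^+ 2)) ?exprn_gt0// -exprMn kw; nra.
  nra.
(* w >= (u + v) / 2, by concavity of the square root *)
have uvw : u + v <= 2 * w.
  rewrite -(@ler_pXn2r _ 2)// ?nnegrE ?addr_ge0 ?mulr_ge0//; nra.
have h1 : 2^-1 * k * (S - w) ^+ 2 <= c * (S - w) ^+ 2.
  by apply: ler_wpM2r; [exact: sqr_ge0|lra].
have h2 : c * (S - w) ^+ 2 <= c * (2^-1 * (S - u) ^+ 2 + 2^-1 * (S - v) ^+ 2).
  apply: ler_wpM2l => //; nra.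
have := le_trans h1 h2; set B := c * (_ + _) => h3.
suff : 2^-1 * k * s + (2^-1 * (v * w) - 2^-1 * b)
   - (2^-1 * (u * w) - 2^-1 * a)
   = 2^-1 * (S - u) ^+ 2 - 2^-1 * (S - v) ^+ 2 + 2^-1 * k * (S - w) ^+ 2.
  by move=> ->; lra.
rewrite -S2 -u2 -v2.
have -> : v = k * w + u by rewrite kw subrK.
have : w ^+ 2 = ((k * w + u) ^+ 2 + u ^+ 2) / 2 by rewrite kw subrK w2 u2 v2; lra.
clearbody k; clear -wN; nra.
Qed.

(** The extended convention [0 / 0 = 0] agrees with the inverse of a field, for
    which [0^-1 = 0]; the hypothesis excludes [a / 0] with [a > 0]. *)
Lemma sqrte_ratio a r : 0 <= a -> 0 <= r -> (r = 0 -> a = 0) ->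
  sqrte (a%:E / r%:E)%E = (Num.sqrt a / Num.sqrt r)%:E.
Proof.
move=> a0 r0 ra; have [rE|rN] := eqVneq r 0.
  by rewrite (ra rE) mul0e sqrte0 sqrtr0 mul0r.
by rewrite inver (negbTE rN) -EFinM /= sqrtrM// sqrtrV.
Qed.

Lemma sqrte_odds a b : 0 <= a -> 0 <= b -> 0 < a + b ->
  sqrte (1 / (1 + a%:E / b%:E))%E = (Num.sqrt (b / (a + b)))%:E.
Proof.
move=> a0 b0 ab; have [bE|bN] := eqVneq b 0.
  have aN : 0 < a by move: ab; rewrite bE addr0.
  by rewrite bE mul0r sqrtr0 inver eqxx gt0_muley ?lte_fin// addey// invey mule0 sqrte0.
have bp : 0 < b by rewrite lt_def bN.
rewrite inver (negbTE bN) -!EFinM -EFinD inver ifF; last first.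
  by apply/negbTE; rewrite gt_eqF// ltr_pwDl// divr_ge0.
rewrite -EFinM /=; congr (Num.sqrt _)%:E.
by field; rewrite bN gt_eqF.
Qed.

Lemma psi_fin a b : 0 <= a -> 0 <= b ->
  (((Num.sqrt 2)^-1)%:E * (sqrte (1 / (1 + a%:E / b%:E))
    - sqrte (1 / (1 + b%:E / a%:E))))%E = (psir a b)%:E.
Proof.
move=> a0 b0; have [abE|abN] := eqVneq (a + b) 0.
  have aE : a = 0 by lra.
  have bE : b = 0 by lra.
  by rewrite aE bE mul0e adde0 inve1 mule1 /= subee// mule0 /psir !sqrtr0 !mul0r subrr mulr0.
have ab : 0 < a + b by rewrite lt_def abN addr_ge0.
have ba : 0 < b + a by rewrite addrC.
rewrite (sqrte_odds a0 b0 ab) (sqrte_odds b0 a0 ba) (addrC b a) -EFinB -EFinM; congr _%:E.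
rewrite /psir !sqrtrM ?invr_ge0// ?addr_ge0// !sqrtrV// ?addr_ge0// !invfM !invrK.
have -> : 2^-1 = (Num.sqrt 2)^-1 * (Num.sqrt 2)^-1 :> R.
  by rewrite -expr2 exprVn sqr_sqrtr.
have s2 : Num.sqrt 2 != 0 :> R by rewrite sqrtr_eq0 -ltNge.
have sab : Num.sqrt (a + b) != 0 by rewrite sqrtr_eq0 -ltNge.
by field; rewrite s2 sab.
Qed.

End Pointwise.

(** * Measurability and integration of tuples *)

Section Measurability.
Context (R : realType) (d : measure_display) (T : measurableType d).
Implicit Types f g : T -> R.
Local Open Scope ring_scope.

Lemma measurable_fun_sqrt f : measurable_fun [set: T] f ->
  measurable_fun [set: T] (fun x => Num.sqrt (f x)).
Proof.
move=> mf; apply: measurableT_comp mf.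
by apply: continuous_measurable_fun; exact: sqrt_continuous.
Qed.

(** On nonnegative reals the inverse is the power function of exponent [-1],
    which is measurable, although it is discontinuous at [0]. *)
Lemma measurable_fun_inv f : measurable_fun [set: T] f ->
  (forall x, 0 <= f x) -> measurable_fun [set: T] (fun x => (f x)^-1).
Proof.
move=> mf f0; rewrite (_ : (fun x => _) = (fun x => f x `^ (-1))).
  by apply: (measurableT_comp (measurable_powR _)) mf.
by apply/funext => x; rewrite powR_inv1.
Qed.

Lemma measurable_sqrt_ratio f g : measurable_fun [set: T] f ->
  measurable_fun [set: T] g ->
  measurable_fun [set: T] (fun x => Num.sqrt (f x) / Num.sqrt ((f x + g x) / 2)).
Proof.
move=> mf mg; apply: measurable_funM; first exact: measurable_fun_sqrt.
apply: measurable_fun_inv; last by move=> x; exact: sqrtr_ge0.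
apply: measurable_fun_sqrt; apply: measurable_funM => //.
exact: measurable_funD.
Qed.

Lemma measurable_sqdist f g : measurable_fun [set: T] f ->
  measurable_fun [set: T] g ->
  measurable_fun [set: T] (fun x => sqdist (f x) (g x)).
Proof.
move=> mf mg; apply: measurable_funX; apply: measurable_funB;
  exact: measurable_fun_sqrt.
Qed.

Lemma measurable_psir f g : measurable_fun [set: T] f ->
  measurable_fun [set: T] g ->
  measurable_fun [set: T] (fun x => psir (f x) (g x)).
Proof.
move=> mf mg; apply: measurable_funM => //; apply: measurable_funB.
  under eq_fun do rewrite addrC.
  exact: measurable_sqrt_ratio.
exact: measurable_sqrt_ratio.
Qed.

End Measurability.

Section TupleIntegral.
Context (R : realType) (k : nat) (dX : 'I_k -> measure_display)
  (X : forall i : 'I_k, measurableType (dX i)).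
Implicit Types (nu mu : mtuple R X) (f g s t r : ftuple R X).

Definition integrable_tuple nu f : Prop :=
  forall i, (nu i).-integrable [set: X i] (EFin \o f i).

Definition Rint_tuple nu f : R := (\sum_(i < k) \int[nu i]_x f i x)%R.

Lemma integral_tupleE nu f : integrable_tuple nu f ->
  integral_tuple nu (fun i x => (f i x)%:E) = (Rint_tuple nu f)%:E.
Proof.
move=> If; rewrite /integral_tuple /Rint_tuple -sumEFin; apply: eq_bigr => i _.
by rewrite /Rintegral fineK//; exact: (integrable_fin_num _ (If i)).
Qed.

Lemma integrable_tupleD nu f g : integrable_tuple nu f -> integrable_tuple nu g ->
  integrable_tuple nu (fun i x => f i x + g i x)%R.
Proof. by move=> If Ig i; have := integrableD measurableT (If i) (Ig i). Qed.

Lemma integrable_tupleB nu f g : integrable_tuple nu f -> integrable_tuple nu g ->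
  integrable_tuple nu (fun i x => f i x - g i x)%R.
Proof. by move=> If Ig i; have := integrableB measurableT (If i) (Ig i). Qed.

Lemma integrable_tupleZ nu c f : integrable_tuple nu f ->
  integrable_tuple nu (fun i x => c * f i x)%R.
Proof. by move=> If i; have := integrableZl measurableT c (If i). Qed.

Lemma Rint_tupleD nu f g : integrable_tuple nu f -> integrable_tuple nu g ->
  Rint_tuple nu (fun i x => f i x + g i x)%R = (Rint_tuple nu f + Rint_tuple nu g)%R.
Proof.
move=> If Ig; rewrite /Rint_tuple -big_split; apply: eq_bigr => i _.
exact: RintegralD.
Qed.

Lemma Rint_tupleB nu f g : integrable_tuple nu f -> integrable_tuple nu g ->
  Rint_tuple nu (fun i x => f i x - g i x)%R = (Rint_tuple nu f - Rint_tuple nu g)%R.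
Proof.
move=> If Ig; rewrite /Rint_tuple -sumrB; apply: eq_bigr => i _.
exact: RintegralB.
Qed.

Lemma Rint_tupleZ nu c f : integrable_tuple nu f ->
  Rint_tuple nu (fun i x => c * f i x)%R = (c * Rint_tuple nu f)%R.
Proof.
move=> If; rewrite /Rint_tuple mulr_sumr; apply: eq_bigr => i _.
exact: RintegralZl.
Qed.

Lemma le_Rint_tuple nu f g : integrable_tuple nu f -> integrable_tuple nu g ->
  (forall i x, f i x <= g i x)%R -> (Rint_tuple nu f <= Rint_tuple nu g)%R.
Proof.
move=> If Ig fg; rewrite /Rint_tuple; apply: ler_sum => i _.
by apply: le_Rintegral => // x _; exact: fg.
Qed.

Lemma le_integrable_tuple nu f g :
  (forall i, measurable_fun [set: X i] (f i)) ->
  (forall i x, `|f i x| <= g i x)%R -> integrable_tuple nu g -> integrable_tuple nu f.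
Proof.
move=> mf fg Ig i; apply: (le_integrable measurableT _ _ (Ig i)).
  exact/measurable_EFinP.
move=> x _ /=; rewrite lee_fin; apply: le_trans (fg i x) _; exact: ler_norm.
Qed.

Lemma bounded_integrable_tuple nu (c : R) f :
  (forall i, nu i [set: X i] < +oo) ->
  (forall i, measurable_fun [set: X i] (f i)) ->
  (forall i x, `|f i x| <= c)%R -> integrable_tuple nu f.
Proof.
move=> nufin mf fc i; apply: measurable_bounded_integrable => //.
exists c; split; first exact: num_real.
by move=> M cM x _; apply: le_trans (fc i x) _; exact: ltW.
Qed.

End TupleIntegral.

(** * Test statistic *)

Section TestStatistic.
Context (R : realType) (k : nat) (dX : 'I_k -> measure_display)
  (X : forall i : 'I_k, measurableType (dX i)).
Implicit Types (nu mu : mtuple R X) (f g s t r : ftuple R X).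
Implicit Type pen : ftuple R X -> R.

(** [h2], [rcrit] and [rZ] are the real values of [H2], of [T_crit] at the mean of
    the two tuples, and of [Z]: all the integrals involved are finite when the
    tuples of functions are in [calL] and the observed measures are finite. *)
Definition h2 mu t t' : R :=
  (2^-1 * Rint_tuple mu (fun i x => sqdist (t i x) (t' i x)))%R.

Lemma integrable_tuple_sqdist mu t t' : calL mu t -> calL mu t' ->
  integrable_tuple mu (fun i x => sqdist (t i x) (t' i x)).
Proof.
move=> Lt Lt'.
apply: (@le_integrable_tuple _ _ _ _ _ _ (fun i x => t i x + t' i x)%R).
- move=> i; have [_ mt _] := Lt i; have [_ mt' _] := Lt' i.
  exact: measurable_sqdist.
- move=> i x; have [t0 _ _] := Lt i; have [t0' _ _] := Lt' i.
  by rewrite ger0_norm ?sqdist_ge0// sqdist_le.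
- by apply: integrable_tupleD => i; [have [] := Lt i|have [] := Lt' i].
Qed.

Lemma H2E mu t t' : calL mu t -> calL mu t' -> H2 mu t t' = (h2 mu t t')%:E.
Proof.
by move=> Lt Lt'; rewrite /H2 (integral_tupleE (integrable_tuple_sqdist Lt Lt')).
Qed.

Lemma h2C mu t t' : h2 mu t t' = h2 mu t' t.
Proof.
congr (_ * Rint_tuple _ _)%R; apply: functional_extensionality_dep => i.
by apply/funext => x; rewrite sqdistC.
Qed.

Lemma h2_ge0 mu t t' : (0 <= h2 mu t t')%R.
Proof.
rewrite mulr_ge0// /Rint_tuple sumr_ge0// => i _.
by apply: Rintegral_ge0 => x _; exact: sqdist_ge0.
Qed.

Lemma h2_young mu (c : R) s t t' : (0 < c)%R ->
  calL mu s -> calL mu t -> calL mu t' ->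
  (h2 mu t t' <= (1 + c) * h2 mu s t + (1 + c^-1) * h2 mu s t')%R.
Proof.
move=> c0 Ls Lt Lt'.
have Ist := integrable_tuple_sqdist Ls Lt; have Ist' := integrable_tuple_sqdist Ls Lt'.
rewrite /h2 !(mulrCA _ 2^-1%R) -mulrDr ler_pM2l//.
rewrite -(Rint_tupleZ _ Ist) -(Rint_tupleZ _ Ist') -Rint_tupleD; [|exact: integrable_tupleZ..].
apply: le_Rint_tuple => [||i x]; first exact: integrable_tuple_sqdist.
  by apply: integrable_tupleD; exact: integrable_tupleZ.
exact: sqdist_young.
Qed.

Lemma calL_mean mu t t' : calL mu t -> calL mu t' -> calL mu (mean_tuple t t').
Proof.
move=> Lt Lt' i; have [t0 mt It] := Lt i; have [t0' mt' It'] := Lt' i.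
split => [x||].
- by rewrite /mean_tuple divr_ge0// addr_ge0.
- by apply: measurable_funM => //; exact: measurable_funD.
- have := integrableZl measurableT 2^-1%R (integrableD measurableT It It').
  apply: eq_integrable => // x _.
  by rewrite /= /mean_tuple mulrC EFinM EFinD.
Qed.

Lemma mean_tupleC t t' : mean_tuple t t' = mean_tuple t' t.
Proof.
apply: functional_extensionality_dep => i; apply/funext => x.
by rewrite /mean_tuple addrC.
Qed.

Definition rcrit mu pen nu t t' : R :=
  (2^-1 * (Rint_tuple mu (fun i x => Num.sqrt (t i x * mean_tuple t t' x))
    + Rint_tuple nu (fun i x => Num.sqrt (t i x) / Num.sqrt (mean_tuple t t' x)))
  - 2^-1 * Rint_tuple mu t - pen t)%R.

Lemma integrable_tuple_sqrt_mean mu t t' : calL mu t -> calL mu t' ->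
  integrable_tuple mu (fun i x => Num.sqrt (t i x * mean_tuple t t' x)).
Proof.
move=> Lt Lt'; have Lr := calL_mean Lt Lt'.
apply: (@le_integrable_tuple _ _ _ _ _ _ (fun i x => t i x + mean_tuple t t' x)%R).
- move=> i; have [_ mt _] := Lt i; have [_ mr _] := Lr i.
  by apply: measurable_fun_sqrt; exact: measurable_funM.
- move=> i x; have [t0 _ _] := Lt i; have [r0 _ _] := Lr i.
  by rewrite ger0_norm ?sqrtr_ge0// sqrt_mul_le.
- by apply: integrable_tupleD => i; [have [] := Lt i|have [] := Lr i].
Qed.

(** The ratio is bounded because the mean of [t] and [t'] is at least half of
    [t]; this is what makes the test statistic finite. *)
Lemma integrable_tuple_sqrt_ratio mu nu t t' :
  (forall i, nu i [set: X i] < +oo) -> calL mu t -> calL mu t' ->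
  integrable_tuple nu
    (fun i x => Num.sqrt (t i x) / Num.sqrt (mean_tuple t t' x))%R.
Proof.
move=> nu_fin Lt Lt'.
apply: (@bounded_integrable_tuple _ _ _ _ _ 2%R) => // i.
  have [_ mt _] := Lt i; have [_ mt' _] := Lt' i.
  exact: measurable_sqrt_ratio.
move=> x; have [t0 _ _] := Lt i; have [t0' _ _] := Lt' i.
by rewrite ger0_norm ?divr_ge0 ?sqrtr_ge0// sqrt_ratio_le2.
Qed.

Lemma T_critE mu nu pen t t' :
  (forall i, nu i [set: X i] < +oo) -> calL mu t -> calL mu t' ->
  T_crit mu pen nu t (mean_tuple t t') = (rcrit mu pen nu t t')%:E.
Proof.
move=> nu_fin Lt Lt'; have Lr := calL_mean Lt Lt'.
have It : integrable_tuple mu t by move=> i; have [] := Lt i.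
rewrite /T_crit /rho_r /rho (integral_tupleE (integrable_tuple_sqrt_mean Lt Lt')).
rewrite (integral_tupleE It).
suff -> : integral_tuple nu
    (fun i x => sqrte ((t i x)%:E / (mean_tuple t t' x)%:E)) =
    (Rint_tuple nu (fun i x =>
      Num.sqrt (t i x) / Num.sqrt (mean_tuple t t' x))%R)%:E by [].
rewrite -(integral_tupleE (integrable_tuple_sqrt_ratio nu_fin Lt Lt')).
apply: eq_bigr => i _; apply: eq_integral => x _.
have [t0 _ _] := Lt i; have [t0' _ _] := Lt' i; have [r0 _ _] := Lr i.
apply: sqrte_ratio => //; rewrite /mean_tuple.
by have := t0 x; have := t0' x; lra.
Qed.

Lemma T_statE mu nu pen t t' :
  (forall i, nu i [set: X i] < +oo) -> calL mu t -> calL mu t' ->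
  T_stat mu pen nu t t' = (rcrit mu pen nu t' t - rcrit mu pen nu t t')%:E.
Proof.
move=> nu_fin Lt Lt'.
rewrite /T_stat /= (T_critE _ nu_fin Lt Lt') {1}mean_tupleC.
by rewrite (T_critE _ nu_fin Lt' Lt) EFinB.
Qed.

Definition rpsi t t' : ftuple R X := fun i x => psir (t i x) (t' i x).

Lemma integrable_tuple_psi mu nu t t' :
  (forall i, nu i [set: X i] < +oo) -> calL mu t -> calL mu t' ->
  integrable_tuple nu (rpsi t t').
Proof.
move=> nu_fin Lt Lt'; apply: (@bounded_integrable_tuple _ _ _ _ _ 1%R) => // i.
  have [_ mt _] := Lt i; have [_ mt' _] := Lt' i; exact: measurable_psir.
move=> x; have [t0 _ _] := Lt i; have [t0' _ _] := Lt' i; exact: psir_bound.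
Qed.

Lemma integrable_tuple_psi_intensity mu s t t' :
  calL mu s -> calL mu t -> calL mu t' ->
  integrable_tuple mu (fun i x => rpsi t t' x * s i x)%R.
Proof.
move=> Ls Lt Lt'; apply: (@le_integrable_tuple _ _ _ _ _ _ s).
- move=> i; have [_ mt _] := Lt i; have [_ mt' _] := Lt' i.
  have [_ ms _] := Ls i.
  by apply: measurable_funM => //; exact: measurable_psir.
- move=> i x; have [t0 _ _] := Lt i; have [t0' _ _] := Lt' i.
  have [s0 _ _] := Ls i.
  by rewrite normrM (ger0_norm (s0 x)) ler_piMl// psir_bound.
- by move=> i; have [] := Ls i.
Qed.

Definition rZ mu s nu t t' : R :=
  (Rint_tuple nu (rpsi t t') - Rint_tuple mu (fun i x => rpsi t t' x * s i x))%R.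

Lemma ZE mu nu s t t' :
  (forall i, nu i [set: X i] < +oo) ->
  calL mu s -> calL mu t -> calL mu t' ->
  Z mu s nu t t' = (rZ mu s nu t t')%:E.
Proof.
move=> nu_fin Ls Lt Lt'.
have psiE i x : psi t t' x = (psir (t i x) (t' i x))%:E.
  have [t0 _ _] := Lt i; have [t0' _ _] := Lt' i; exact: psi_fin.
rewrite /rZ EFinB -(integral_tupleE (integrable_tuple_psi nu_fin Lt Lt')).
rewrite -(integral_tupleE (integrable_tuple_psi_intensity Ls Lt Lt')).
congr (_ - _); apply: eq_bigr => i _; apply: eq_integral => x _ //.
by rewrite psiE EFinM.
Qed.

Lemma Rint_tuple_rpsi mu nu t t' :
  (forall i, nu i [set: X i] < +oo) -> calL mu t -> calL mu t' ->
  Rint_tuple nu (rpsi t t') = (2^-1 *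
    (Rint_tuple nu (fun i x => Num.sqrt (t' i x) / Num.sqrt (mean_tuple t' t x))
     - Rint_tuple nu (fun i x => Num.sqrt (t i x) / Num.sqrt (mean_tuple t t' x))))%R.
Proof.
move=> nu_fin Lt Lt'.
have I1 := integrable_tuple_sqrt_ratio nu_fin Lt Lt'.
have I2 := integrable_tuple_sqrt_ratio nu_fin Lt' Lt.
rewrite -Rint_tupleB// -Rint_tupleZ; last exact: integrable_tupleB.
congr Rint_tuple; apply: functional_extensionality_dep => i; apply/funext => x.
by rewrite /rpsi /psir /mean_tuple (addrC (t' i x)).
Qed.

(** The integrals with respect to [nu] of the two sides cancel, by [Rint_tuple_rpsi];
    what remains is the integral of [psir_drift] with respect to [mu]. *)
Lemma T_stat_drift mu nu pen s t t' :
  (forall i, nu i [set: X i] < +oo) ->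
  calL mu s -> calL mu t -> calL mu t' ->
  (rcrit mu pen nu t' t - rcrit mu pen nu t t' <=
   rZ mu s nu t t' + h2 mu s t - h2 mu s t'
   + (Num.sqrt 2)^-1 * (h2 mu s t + h2 mu s t') + pen t - pen t')%R.
Proof.
move=> nu_fin Ls Lt Lt'.
have It : integrable_tuple mu t by move=> i; have [] := Lt i.
have It' : integrable_tuple mu t' by move=> i; have [] := Lt' i.
have Ir := integrable_tuple_sqrt_mean Lt Lt'; have Ir' := integrable_tuple_sqrt_mean Lt' Lt.
have Ip := integrable_tuple_psi_intensity Ls Lt Lt'.
have Is := integrable_tuple_sqdist Ls Lt; have Is' := integrable_tuple_sqdist Ls Lt'.
have drift i x : (rpsi t t' x * s i x
  + (2^-1 * Num.sqrt (t' i x * mean_tuple t' t x) - 2^-1 * t' i x)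
  - (2^-1 * Num.sqrt (t i x * mean_tuple t t' x) - 2^-1 * t i x)
  <= 2^-1 * sqdist (s i x) (t i x) - 2^-1 * sqdist (s i x) (t' i x)
     + (Num.sqrt 2)^-1 * (2^-1 * sqdist (s i x) (t i x)
                          + 2^-1 * sqdist (s i x) (t' i x)))%R.
  have [t0 _ _] := Lt i; have [t0' _ _] := Lt' i; have [s0 _ _] := Ls i.
  have := psir_drift (t0 x) (t0' x) (s0 x).
  by rewrite /rpsi /mean_tuple (addrC (t' i x)); lra.
have Zt f : integrable_tuple mu f -> integrable_tuple mu (fun i x => 2^-1 * f i x)%R.
  exact: integrable_tupleZ.
have Icrit' := integrable_tupleB (Zt _ Ir') (Zt _ It').
have Icrit := integrable_tupleB (Zt _ Ir) (Zt _ It).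
have Isum := integrable_tupleD (Zt _ Is) (Zt _ Is').
have Idiff := integrable_tupleB (Zt _ Is) (Zt _ Is').
have {drift} := le_Rint_tuple (integrable_tupleB (integrable_tupleD Ip Icrit') Icrit)
  (integrable_tupleD Idiff (integrable_tupleZ (Num.sqrt 2)^-1 Isum)) drift.
rewrite (Rint_tupleB (integrable_tupleD Ip Icrit') Icrit) (Rint_tupleD Ip Icrit').
rewrite (Rint_tupleB (Zt _ Ir') (Zt _ It')) (Rint_tupleB (Zt _ Ir) (Zt _ It)).
rewrite (Rint_tupleD Idiff (integrable_tupleZ _ Isum)) (Rint_tupleZ _ Isum).
rewrite (Rint_tupleB (Zt _ Is) (Zt _ Is')) (Rint_tupleD (Zt _ Is) (Zt _ Is')).
rewrite (Rint_tupleZ _ Ir) (Rint_tupleZ _ Ir') (Rint_tupleZ _ It) (Rint_tupleZ _ It').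
rewrite (Rint_tupleZ _ Is) (Rint_tupleZ _ Is').
rewrite /rcrit /rZ (Rint_tuple_rpsi nu_fin Lt Lt') /h2; lra.
Qed.

End TestStatistic.

(** * Constants of the risk bound *)

Section ConstantsTheory.
Context (R : realType).
Implicit Types z h p tau xi D : R.
Local Open Scope ring_scope.

Lemma kappa_itv z : 0 < z -> z < 1 - 1 / Num.sqrt 2 -> 0 < kappa z < 1.
Proof.
move=> z0 z1; rewrite /kappa addr_gt0//= ?divr_gt0 ?sqrtr_gt0//; lra.
Qed.

Lemma sqrt_alpha_gt0 z : 0 < kappa z < 1 -> 0 < Num.sqrt (alpha z).
Proof. by case/andP => ? ?; rewrite sqrtr_gt0 divr_gt0//; lra. Qed.

Lemma sqrt_alpha_sqr z : 0 < kappa z < 1 ->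
  (1 - kappa z) * Num.sqrt (alpha z) ^+ 2 = 1 + kappa z.
Proof.
case/andP => k0 k1; rewrite sqr_sqrtr; last by rewrite divr_ge0//; lra.
by rewrite /alpha; field; lra.
Qed.

Lemma sqrt_alpha_mul z : 0 < kappa z < 1 ->
  (1 - kappa z) * Num.sqrt (alpha z) = Num.sqrt (1 - kappa z ^+ 2).
Proof.
move=> kz; have /andP[k0 k1] := kz; have b0 := sqrt_alpha_gt0 kz.
rewrite -[LHS]ger0_norm; last by rewrite mulr_ge0//; lra.
by rewrite -sqrtr_sqr exprMn expr2 -mulrA sqrt_alpha_sqr//; congr Num.sqrt; ring.
Qed.

(** Here [D] stands for the loss between the selected estimator and a competitor
    of risk [h] and penalty [p], and the left-hand side of the conclusion is the
    bound given by [h2_young] with [c = 1 + sqrt alpha]. The term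
    [tau / (1 + sqrt alpha)] is absorbed by the penalty, since [z tau <= p]. *)
Lemma C1_C2_bound z h p tau xi D :
  0 < z -> 0 < kappa z < 1 -> 0 <= h -> 0 <= p -> z * tau <= p ->
  let b := Num.sqrt (alpha z) in
  D <= (1 + b) * ((1 + b) * h
                  + (2 * p + z * tau * xi) / Num.sqrt (1 - kappa z ^+ 2)) + tau ->
  (1 + (1 + b)) * h + (1 + (1 + b)^-1) * D
  <= C1 z * (h + p) + C2 z * tau * xi.
Proof.
move=> z0 kz h0 p0 ztp b; have /andP[k0 k1] := kz.
have b0 : 0 < b := sqrt_alpha_gt0 kz.
have c0 : 0 < Num.sqrt (1 - kappa z ^+ 2).
  by rewrite -sqrt_alpha_mul// mulr_gt0//; lra.
rewrite /C1 /C2 -/b; set c := Num.sqrt _ in c0 *; set M := Num.max _ _ => DD.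
have b1 : 0 < 1 + b by lra.
have M1 : (2 + b) * h <= M * h.
  by rewrite ler_wpM2r// le_max lexx.
have M2 : (2 / c + 1 / (z * (1 + b))) * p <= M * p.
  by rewrite ler_wpM2r// le_max lexx orbT.
have tp : tau / (1 + b) <= 1 / (z * (1 + b)) * p.
  rewrite ler_pdivrMr//.
  have -> : 1 / (z * (1 + b)) * p * (1 + b) = p / z by field; lra.
  by rewrite ler_pdivlMr// mulrC.
have kD : (1 + (1 + b)^-1) * D <= (1 + (1 + b)^-1) *
   ((1 + b) * ((1 + b) * h + (2 * p + z * tau * xi) / c) + tau).
  by rewrite ler_wpM2l// addr_ge0// invr_ge0 ltW.
have E : (1 + (1 + b)) * h + (1 + (1 + b)^-1) *
   ((1 + b) * ((1 + b) * h + (2 * p + z * tau * xi) / c) + tau)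
   = (2 + b) * ((2 + b) * h + (2 / c * p + tau / (1 + b)))
     + z * (2 + b) / c * tau * xi.
  by field; lra.
have F : (2 + b) * ((2 + b) * h + (2 / c * p + tau / (1 + b)))
   <= (2 + b) * M * (h + p).
  rewrite -(mulrA _ M) ler_wpM2l//; first lra.
  rewrite mulrDr; lra.
lra.
Qed.

Lemma C1_gt0 (z : R) : 0 < kappa z < 1 -> 0 < C1 z.
Proof.
move=> kz; have b0 := sqrt_alpha_gt0 kz.
have b2 : 0 < 2 + Num.sqrt (alpha z) by lra.
by rewrite /C1 mulr_gt0// lt_max b2.
Qed.

Lemma C2_gt0 (z : R) : 0 < z -> 0 < kappa z < 1 -> 0 < C2 z.
Proof.
move=> z0 kz; have b0 := sqrt_alpha_gt0 kz; have /andP[_ k1] := kz.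
have b2 : 0 < 2 + Num.sqrt (alpha z) by lra.
by rewrite /C2 -(sqrt_alpha_mul kz) divr_gt0// mulr_gt0// subr_gt0.
Qed.

End ConstantsTheory.

(** * Selection *)

Section Selection.
Context (R : realType) (k : nat) (dX : 'I_k -> measure_display)
  (X : forall i : 'I_k, measurableType (dX i)).
Implicit Types (nu mu : mtuple R X) (s t : ftuple R X).
Implicit Type pen : ftuple R X -> R.

Definition deviation_bound mu nu s pen (z tau xi : R) t t' : Prop :=
  (rZ mu s nu t t' <= z * (h2 mu s t + h2 mu s t') + pen t + pen t'
                      + z * tau * xi)%R.

(** A tuple [t'] preferred to [t] has risk at most
    [alpha h2(s,t) + (2 pen t + z tau xi) / (1 - kappa)], by [T_stat_drift]. The
    conclusion is then [h2_young] with the optimal [c = sqrt alpha], for which the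
    two terms in [h2(s,t)] add up to [(1 + sqrt alpha)^2 h2(s,t)]. *)
Lemma h2_preferred_le mu nu s pen (z tau xi : R) t t' :
  (forall i, nu i [set: X i] < +oo) ->
  calL mu s -> calL mu t -> calL mu t' -> (0 < kappa z < 1)%R ->
  deviation_bound mu nu s pen z tau xi t t' ->
  (0 <= rcrit mu pen nu t' t - rcrit mu pen nu t t')%R ->
  (h2 mu t t' <= (1 + Num.sqrt (alpha z)) * ((1 + Num.sqrt (alpha z)) * h2 mu s t
     + (2 * pen t + z * tau * xi) / Num.sqrt (1 - kappa z ^+ 2)))%R.
Proof.
move=> nu_fin Ls Lt Lt' kz dev T0; set b := Num.sqrt (alpha z).
have /andP[k0 k1] := kz.
have b0 : (0 < b)%R := sqrt_alpha_gt0 kz.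
have b2 : ((1 - kappa z) * b ^+ 2 = 1 + kappa z)%R := sqrt_alpha_sqr kz.
apply: le_trans (h2_young b0 Ls Lt Lt') _.
have := T_stat_drift pen nu_fin Ls Lt Lt'; move: dev; rewrite /deviation_bound.
move: T0 b2; rewrite -(sqrt_alpha_mul kz) -/b.
have kE : (kappa z = z + (Num.sqrt 2)^-1)%R by rewrite /kappa mul1r.
move: (rcrit _ _ _ _ _) (rcrit _ _ _ _ _) (rZ _ _ _ _ _) => T' T Zt.
have := h2_ge0 mu s t; have := h2_ge0 mu s t'.
move: (h2 mu s t) (h2 mu s t') => h h' h'0 h0 T0 b2 dev drift.
have main : ((1 - kappa z) * h' <= (1 + kappa z) * h + (2 * pen t + z * tau * xi))%R.
  rewrite kE; lra.
set Q := (2 * pen t + _)%R in main *.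
have -> : ((1 + b) * ((1 + b) * h + Q / ((1 - kappa z) * b)) =
  (1 + b) * h + (1 + b^-1) * (b ^+ 2 * h + Q / (1 - kappa z)))%R.
  by field; lra.
rewrite lerD2l ler_wpM2l//; first by rewrite addr_ge0// invr_ge0 ltW.
have k1' : (0 < 1 - kappa z)%R by lra.
rewrite -(ler_pM2l k1') mulrDr mulrA b2 (mulrC _ (Q / _)%R) divfK//.
by rewrite gt_eqF.
Qed.

Lemma h2xx mu t : h2 mu t t = 0%R.
Proof.
rewrite /h2 /Rint_tuple big1 ?mulr0// => i _; rewrite /Rintegral.
by rewrite integral0_eq// => x _; rewrite /sqdist subrr expr0n.
Qed.

(** Deterministic part of the argument, for one observation: randomness enters
    through the deviation bound and the finiteness of the observed measures. *)
Lemma selected_risk_le mu nu s pen (z tau xi : R) (Lambda : Type)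
    (est : Lambda -> ftuple R X) (l0 : Lambda) :
  (forall i, nu i [set: X i] < +oo) ->
  calL mu s -> (forall l, calL mu (est l)) ->
  (0 < z)%R -> (0 < kappa z < 1)%R -> (0 < tau)%R -> (0 < xi)%R ->
  (forall l, z * tau <= pen (est l))%R ->
  (forall l l', deviation_bound mu nu s pen z tau xi (est l) (est l')) ->
  (forall l, calD mu pen nu est (est l0) <= calD mu pen nu est (est l) + tau%:E) ->
  forall l, (h2 mu s (est l0)
    <= C1 z * (h2 mu s (est l) + pen (est l)) + C2 z * tau * xi)%R.
Proof.
move=> nu_fin Ls Le z0 kz tau0 xi0 penge dev l0min l.
set t := est l; set t0 := est l0.
have Lt : calL mu t := Le l.
have Lt0 : calL mu t0 := Le l0.
have b0 := sqrt_alpha_gt0 kz; have /andP[k0 k1] := kz.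
have p0 : (0 <= pen t)%R by apply: le_trans (penge l); rewrite mulr_ge0// ltW.
have c0 : (0 < Num.sqrt (1 - kappa z ^+ 2))%R.
  by rewrite -sqrt_alpha_mul// mulr_gt0//; lra.
have h0 := h2_ge0 mu s t.
have b1 : (0 < 1 + Num.sqrt (alpha z))%R by lra.
apply: le_trans (h2_young b1 Lt Ls Lt0) _; rewrite (h2C _ t s).
apply: C1_C2_bound => //; first exact: penge.
set D := ((1 + _) * _)%R.
have D0 : (0 <= D)%R.
  apply: mulr_ge0; first exact: ltW.
  apply: addr_ge0; first by rewrite mulr_ge0// ltW.
  apply: divr_ge0; last exact: ltW.
  by rewrite addr_ge0 ?mulr_ge0 // ltW.
have pref t' : calE mu pen nu est t t' -> (h2 mu t t' <= D)%R.
  move=> [[l' _ <-] _]; rewrite T_statE// lee_fin => T0.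
  exact: (h2_preferred_le nu_fin Ls Lt (Le l') kz (dev l l') T0).
have calD_le : calD mu pen nu est t <= D%:E.
  rewrite /calD; case: asboolP => _; last by rewrite lee_fin.
  apply: ge_ereal_sup => _ [t' Et' <-].
  by have [[l' _ l'E] _ _] := Et'; rewrite -l'E H2E// lee_fin l'E; exact: pref.
have [t0E|t0N] := pselect (t0 = t); first by rewrite t0E h2xx addr_ge0// ltW.
(* The one of [t] and [t0] preferred by the test belongs to the set [calE] of the
   other one. *)
have [T0|T0] := lerP 0%R (rcrit mu pen nu t0 t - rcrit mu pen nu t t0)%R.
  apply: (@le_trans _ _ D); last by rewrite lerDl ltW.
  by apply: pref; split => //; rewrite T_statE// lee_fin.
have Et : calE mu pen nu est t0 t.
  split; [by exists l|by move=> tE; exact: t0N|rewrite T_statE// lee_fin; lra].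
rewrite -lee_fin EFinD; apply: le_trans (leeD2r _ calD_le).
apply: le_trans (l0min l); rewrite -/t -/t0 {1}/calD; case: asboolP => [_|]; last first.
  by move=> /(_ (ex_intro _ _ Et)).
by apply: ereal_sup_ubound; exists t => //; rewrite H2E// h2C.
Qed.

End Selection.

(** * Outer probability *)

Section OuterMeasure.
Context (R : realType).

Lemma esumZl_le (T : choiceType) (c : R) (a : T -> \bar R) :
  (0 <= c)%R -> (forall i, 0 <= a i) ->
  \esum_(i in [set: T]) (c%:E * a i) <= c%:E * \esum_(i in [set: T]) a i.
Proof.
move=> c0 a0; apply: ge_ereal_sup => _ [A [Afin AT] <-].
rewrite -ge0_mule_fsumr//; apply: lee_wpmul2l; first by rewrite lee_fin.
by apply: ereal_sup_ubound; exists A.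
Qed.

(** Countable subadditivity is stated for sequences; the family is transported to
    [nat] by [pickle] and completed by empty sets outside its range. *)
Lemma outer_measure_bigcup_countType (Omega : Type)
    (m : {outer_measure set Omega -> \bar R}) (T : countType)
    (F : T -> set Omega) :
  m (\bigcup_t F t) <= \esum_(t in [set: T]) m (F t).
Proof.
pose G n := if pickle_inv n is Some t then F t else set0 : set Omega.
have Gpickle t : G (pickle t) = F t by rewrite /G pickleK_inv.
have -> : \bigcup_t F t = \bigcup_n G n.
  apply/seteqP; split=> w [].
    by move=> t _ Ftw; exists (pickle t) => //; rewrite Gpickle.
  by move=> n _; rewrite /G; case: pickle_inv => // t Ftw; exists t.
apply: (le_trans (outer_measure_sigma_subadditive m G)).
rewrite nneseries_esumT; last by move=> n; exact: outer_measure_ge0.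
rewrite [leRHS](_ : _ = \esum_(n in range (@pickle T)) m (G n)); last first.
  rewrite esum_image; first by apply: eq_esum => t _; rewrite Gpickle.
  by apply: in2W; exact: (pcan_inj pickleK_inv).
rewrite [leRHS]esum_mkcond; apply: le_esum => n _; case: ifPn => //.
rewrite notin_setE => nT; rewrite /G.
have := pickle_invK n (T := T); case: pickle_inv => [t /= tn|_].
  by exfalso; apply: nT; exists t.
by rewrite outer_measure0.
Qed.

End OuterMeasure.

Section Probability.
Context (R : realType) (d : measure_display) (Omega : measurableType d)
  (P : probability Omega R).

Lemma mu_ext_le1 (A : set Omega) : (P^*)%mu A <= 1.
Proof.
rewrite -(@probability_setT _ _ _ P) -(measurable_mu_extE P measurableT).
exact: le_mu_ext.
Qed.

Lemma mu_ext_negligible (A : set Omega) : P.-negligible A -> (P^*)%mu A = 0.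
Proof.
move=> [B [mB PB AB]]; apply/eqP; rewrite eq_le mu_ext_ge0// andbT.
by rewrite -PB -(measurable_mu_extE P mB); exact: le_mu_ext.
Qed.

(** When an observed measure is infinite, the integrals in the test statistic may
    be infinite and [rcrit], [rZ] lose their meaning; this event is discarded. *)
Lemma mu_ext_kernel_infinite (k : nat) (dX : 'I_k -> measure_display)
    (X : forall i : 'I_k, measurableType (dX i))
    (N : forall i : 'I_k, R.-ker Omega ~> X i) :
  (forall i, \int[P]_w N i w [set: X i] < +oo) ->
  (P^*)%mu (\bigcup_i [set w | ~ (N i w [set: X i] < +oo)]) = 0.
Proof.
move=> Nfin; apply/eqP; rewrite eq_le mu_ext_ge0// andbT.
apply: (le_trans (outer_measure_bigcup_countType _ _)).
rewrite esum1// => i _; apply: mu_ext_negligible.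
have IN : P.-integrable [set: Omega] (fun w => N i w [set: X i]).
  apply/integrableP; split; first exact: measurable_kernel.
  by under eq_integral do rewrite gee0_abs//; exact: Nfin.
apply: negligibleS (integrable_ae measurableT IN) => w /= Nw Nw'; apply: Nw.
by have := Nw' I; rewrite fin_numE => /andP[_]; rewrite -ltey.
Qed.

(** A probability [p] with [p <= c exp(- xi + delta)] satisfies
    [p (1 - delta) <= p exp(- delta) <= c exp(- xi)], hence
    [p <= c exp(- xi) + delta]. *)
Lemma mu_ext_exp_left_limit (A : set Omega) (c xi : R) : (0 < xi)%R ->
  (forall xi', (0 < xi' < xi)%R -> (P^*)%mu A <= (c * expR (- xi'))%:E) ->
  (P^*)%mu A <= (c * expR (- xi))%:E.
Proof.
move=> xi0 bnd.
have Afin : (P^*)%mu A \is a fin_num.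
  by rewrite ge0_fin_numE ?mu_ext_ge0//; apply: le_lt_trans (mu_ext_le1 A) _; rewrite ltry.
have A1 : (fine ((P^*)%mu A) <= 1)%R by rewrite -lee_fin fineK// mu_ext_le1.
have A0 : (0 <= fine ((P^*)%mu A))%R by rewrite fine_ge0// mu_ext_ge0.
rewrite -(fineK Afin) in bnd *; move: (fine _) A0 A1 bnd => p p0 p1 bnd.
rewrite lee_fin; apply/ler_addgt0Pr => e e0.
(* The bound is used at the level [xi - delta], which has to stay positive. *)
pose delta : R := Num.min e (xi / 2)%R.
have delta0 : (0 < delta)%R by rewrite lt_min e0/= divr_gt0.
have delta_xi : (delta <= xi / 2)%R by rewrite ge_min lexx orbT.
have delta_e : (delta <= e)%R by rewrite ge_min lexx.
have /bnd : (0 < xi - delta < xi)%R by lra.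
rewrite lee_fin => pb.
have := ler_wpM2r (expR_ge0 (- delta)) pb.
rewrite -mulrA -expRD (_ : (- (xi - delta) + - delta = - xi)%R); last by lra.
have : (p * (1 - delta) <= p * expR (- delta))%R.
  by rewrite ler_wpM2l// expR_ge1Dx.
have : (p * delta <= delta)%R by rewrite ler_piMl// ltW.
lra.
Qed.

End Probability.

(** * From deviations to the uniform bound on [Z] *)

Section Deviations.
Context (R : realType) (k : nat) (dX : 'I_k -> measure_display)
  (X : forall i : 'I_k, measurableType (dX i)).
Implicit Types (nu mu : mtuple R X) (s t : ftuple R X).
Implicit Type pen : ftuple R X -> R.

(** Since [Delta_m >= 1], the penalty can absorb the slack [tau] allowed in the
    minimization of [calD]. *)
Lemma penalty_ge (M : Type) (S : M -> set (ftuple R X)) (dim Delta : M -> R)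
    (z tau : R) t p : (0 < z)%R -> (0 < tau)%R ->
  (forall m, 0 < dim m)%R -> (forall m, 1 <= Delta m)%R ->
  (\bigcup_m S m) t ->
  (z * tau * inf [set dim m + Delta m | m in [set m | S m t]] <= p)%R ->
  (z * tau <= p)%R.
Proof.
move=> z0 tau0 dim0 Delta1 [m _ Smt]; apply: le_trans.
rewrite ler_peMr//; first by rewrite mulr_ge0// ltW.
apply: lb_le_inf; first by exists (dim m + Delta m)%R, m.
by move=> _ [m' _ <-]; rewrite -[leLHS]add0r lerD// ltW.
Qed.

(** The maximum is at most the sum of its arguments and [max (d_m, d_m')] at most
    [d_m + d_m'], which splits the bound of the hypothesis into [z] times the
    losses, the weights [z tau (d_m + Delta_m)] of the two models, and
    [z tau xi]. For models almost optimal for [t] and [t'] these weights exceed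
    the penalties by an arbitrarily small amount. *)
Lemma deviation_bound_of_models mu nu s pen (M : Type)
    (S : M -> set (ftuple R X)) (dim Delta : M -> R) (z tau xi : R) :
  (0 < z)%R -> (0 < tau)%R -> (forall m, 0 < dim m)%R ->
  (forall m, 1 <= Delta m)%R ->
  (forall t, (\bigcup_m S m) t ->
    (z * tau * inf [set dim m + Delta m | m in [set m | S m t]] <= pen t)%R) ->
  (0 < xi)%R ->
  (forall m m' t t', S m t -> S m' t' ->
    (rZ mu s nu t t' <= z * Num.max (h2 mu s t + h2 mu s t')
      (tau * (Num.max (dim m) (dim m') + (Delta m + Delta m' + xi))))%R) ->
  forall t t', (\bigcup_m S m) t -> (\bigcup_m S m) t' ->
    deviation_bound mu nu s pen z tau xi t t'.
Proof.
move=> z0 tau0 dim0 Delta1 hpen xi0 dev.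
have zt : (0 < z * tau)%R by rewrite mulr_gt0.
have near_inf t e : (\bigcup_m S m) t -> (0 < e)%R ->
    exists2 m, S m t & (z * tau * (dim m + Delta m) <= pen t + e)%R.
  move=> St e0; have [m0 _ Sm0] := St.
  have Hinf : has_inf [set dim m + Delta m | m in [set m | S m t]]%R.
    split; first by exists (dim m0 + Delta m0)%R, m0.
    exists 0%R => _ [m _ <-].
    by have := dim0 m; have := Delta1 m; lra.
  have ezt : (0 < e / (z * tau))%R by rewrite divr_gt0.
  have [_ [m Smt <-] lt_m] := inf_adherent ezt Hinf.
  exists m => //; have := hpen _ St.
  have : (z * tau * (dim m + Delta m) <= z * tau *
      (inf [set dim m + Delta m | m in [set m | S m t]] + e / (z * tau)))%R.
    by rewrite ler_pM2l// ltW.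
  by rewrite (mulrDr _ (inf _)) (mulrC _ (e / _)%R) divfK ?gt_eqF//; lra.
move=> t t' St St'; apply/ler_addgt0Pr => e e0.
have e2 : (0 < e / 2)%R by lra.
have [m Smt pm] := near_inf t _ St e2; have [m' Smt' pm'] := near_inf t' _ St' e2.
apply: le_trans (dev _ _ _ _ Smt Smt') _.
have := h2_ge0 mu s t; have := h2_ge0 mu s t'.
have dmax : (Num.max (dim m) (dim m') <= dim m + dim m')%R.
  by rewrite ge_max lerDl lerDr !ltW.
have dmax0 : (0 < Num.max (dim m) (dim m'))%R by rewrite lt_max dim0.
move: (Num.max (dim m) _) dmax dmax0 => D dmax dmax0 h'0 h0.
have p1 : (0 < z * tau * (D + (Delta m + Delta m' + xi)))%R.
  by rewrite mulr_gt0//; have := Delta1 m; have := Delta1 m'; lra.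
have p2 : (z * tau * (D + (Delta m + Delta m' + xi)) <=
    z * tau * ((dim m + Delta m) + (dim m' + Delta m') + xi))%R.
  by rewrite ler_pM2l//; lra.
have p3 : (0 <= z * (h2 mu s t + h2 mu s t'))%R by rewrite mulr_ge0 ?addr_ge0// ltW.
have [h|h] := leP (h2 mu s t + h2 mu s t')%R; rewrite ?mulrA; lra.
Qed.

Lemma rZ_le_of_sup mu nu s (A B : set (ftuple R X)) (z y2 : R) t t' :
  (forall i, nu i [set: X i] < +oo) -> calL mu s ->
  A `<=` calL mu -> B `<=` calL mu -> (0 < y2)%R ->
  ereal_sup [set Z mu s nu tt.1 tt.2 / w2 mu s tt.1 tt.2 (Num.sqrt y2)
            | tt in A `*` B] < z%:E ->
  A t -> B t' ->
  (rZ mu s nu t t' <= z * Num.max (h2 mu s t + h2 mu s t') y2)%R.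
Proof.
move=> nu_fin Ls LA LB y20 supz At Bt'.
have Lt := LA _ At; have Lt' := LB _ Bt'.
have : Z mu s nu t t' / w2 mu s t t' (Num.sqrt y2) <= z%:E.
  by apply: le_trans (ltW supz); apply: ereal_sup_ubound; exists (t, t').
rewrite ZE// /w2 !H2E// -EFinD -EFin_max sqr_sqrtr ?(ltW y20)//.
have W0 : (0 < Num.max (h2 mu s t + h2 mu s t') y2)%R.
  by rewrite lt_max y20 orbT.
by rewrite inver gt_eqF// -EFinM lee_fin ler_pdivrMr.
Qed.

End Deviations.

(** * Risk bound *)

(** Subadditivity is applied to one model at a time; the weights factor as
    [exp(- Delta_m) exp(- Delta_m')], so the double sum is [Sigma^2]. *)
Lemma mu_ext_model_pairs (R : realType) (d : measure_display)
    (Omega : measurableType d) (P : probability Omega R) (M : countType)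
    (B : M -> M -> set Omega) (Delta : M -> R) (gamma xi : R) :
  (0 <= gamma)%R ->
  \esum_(m in [set: M]) (expR (- Delta m))%:E < +oo ->
  (forall m m', (P^*)%mu (B m m')
    <= (gamma * expR (- (Delta m + Delta m' + xi)))%:E) ->
  (P^*)%mu (\bigcup_m \bigcup_m' B m m')
  <= (gamma * fine (\esum_(m in [set: M]) (expR (- Delta m))%:E) ^+ 2
      * expR (- xi))%:E.
Proof.
move=> gamma0 Sigma_lty bndB.
have e0 m : 0 <= (expR (- Delta m))%:E by rewrite lee_fin expR_ge0.
have Sigma_fin : \esum_(m in [set: M]) (expR (- Delta m))%:E \is a fin_num.
  by rewrite ge0_fin_numE// esum_ge0.
set Sigma := \esum_(m in _) _ in Sigma_lty Sigma_fin *.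
have Sigma0 : (0 <= fine Sigma)%R by rewrite fine_ge0// esum_ge0.
apply: (le_trans (outer_measure_bigcup_countType _ _)).
apply: (@le_trans _ _ (\esum_(m in [set: M])
    ((gamma * fine Sigma * expR (- xi))%:E * (expR (- Delta m))%:E))).
  apply: le_esum => m _.
  apply: (le_trans (outer_measure_bigcup_countType _ _)).
  apply: (@le_trans _ _ (\esum_(m' in [set: M])
      ((gamma * expR (- Delta m) * expR (- xi))%:E * (expR (- Delta m'))%:E))).
    apply: le_esum => m' _; apply: le_trans (bndB m m') _.
    by rewrite -EFinM lee_fin !opprD !expRD; lra.
  apply: le_trans (esumZl_le _ _) _ => //; first by rewrite !mulr_ge0 ?expR_ge0.
  by rewrite -/Sigma -(fineK Sigma_fin) -!EFinM lee_fin; lra.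
apply: le_trans (esumZl_le _ _) _ => //; first by rewrite !mulr_ge0 ?expR_ge0.
by rewrite -/Sigma -{2}(fineK Sigma_fin) -!EFinM lee_fin; lra.
Qed.

(* The events below involve suprema over possibly uncountable models and an
   arbitrary selection of lambda-hat, so they need not be measurable:
   probabilities of events are those of the outer probability mu_ext P, which
   agrees with P on measurable sets. *)
Theorem theorem1 (R : realType)
  (dO : measure_display) (Omega : measurableType dO) (P : probability Omega R)
  (k : nat) (hk : (0 < k)%N)
  (dX : 'I_k -> measure_display) (X : forall i : 'I_k, measurableType (dX i))
  (mu : mtuple R X)
  (* the random measures and their intensities *)
  (N : forall i : 'I_k, R.-ker Omega ~> X i)
  (hindep : independent_rmeasures P N)
  (s : ftuple R X)
  (hs0 : forall i x, (0 <= s i x)%R)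
  (hsm : forall i, measurable_fun [set: X i] (s i))
  (hNs : forall i (A : set (X i)), measurable A ->
     \int[P]_w N i w A = \int[mu i]_(x in A) (s i x)%:E
     /\ \int[mu i]_(x in A) (s i x)%:E < +oo)
  (L0 : set (ftuple R X)) (hL0 : L0 `<=` calL mu) (hsL0 : L0 s)
  (* models *)
  (M : countType) (S : M -> set (ftuple R X))
  (hSne : forall m, S m !=set0) (hSL0 : forall m, S m `<=` L0)
  (* estimators: measurable functions of the observation, for an arbitrary
     sigma-algebra G on the set of k-tuples of functions *)
  (Lambda : countType)
  (G : set (set (ftuple R X))) (hG : sigma_algebra [set: ftuple R X] G)
  (shat : Lambda -> mtuple R X -> ftuple R X)
  (hshat : forall l B, G B -> sigma_mtuple (shat l @^-1` B))
  (hshatS : forall l w, (\bigcup_m S m) (shat l (observation N w)))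
  (z tau gamma : R)
  (hz0 : (0 < z)%R) (hz1 : (z < 1 - 1 / Num.sqrt 2)%R)
  (htau : (0 < tau)%R) (hgamma : (0 < gamma)%R)
  (Delta : M -> R) (hDelta0 : forall m, (0 <= Delta m)%R)
  (hSigma : \esum_(m in [set: M]) (expR (- Delta m))%:E < +oo)
  (hDelta1 : forall m, (1 <= Delta m)%R)
  (dim : M -> R) (hdim : forall m, (0 < dim m)%R)
  (hdev : forall (m m' : M) (xi y : R), (0 < xi)%R -> (0 < y)%R ->
     (tau * (Num.max (dim m) (dim m') + xi) <= y ^+ 2)%R ->
     (P^*)%mu [set w | z%:E <= ereal_sup
        [set Z mu s (observation N w) tt.1 tt.2 / w2 mu s tt.1 tt.2 y
          | tt in S m `*` S m']]
     <= (gamma * expR (- xi))%:E)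
  (pen : ftuple R X -> R)
  (hpen0 : forall t, (\bigcup_m S m) t -> (0 <= pen t)%R)
  (hpen : forall t, (\bigcup_m S m) t ->
     (z * tau * inf [set dim m + Delta m | m in [set m | S m t]] <= pen t)%R)
  (* selected index *)
  (lhat : Omega -> Lambda)
  (hlhat : forall w l,
     let est := fun l' => shat l' (observation N w) in
     calD mu pen (observation N w) est (est (lhat w))
     <= calD mu pen (observation N w) est (est l) + tau%:E) :
  forall xi : R, (0 < xi)%R ->
    (P^*)%mu [set w |
       (C1 z)%:E * ereal_inf
          (range (fun l : Lambda => H2 mu s (shat l (observation N w))
                                    + (pen (shat l (observation N w)))%:E))
       + (C2 z * tau * xi)%:E
       <= H2 mu s (shat (lhat w) (observation N w))]
    <= mine (gamma%:E * (\esum_(m in [set: M]) (expR (- Delta m))%:E) ^+ 2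
             * (expR (- xi))%:E) 1.
Proof.
move=> xi xi0.
have kz : (0 < kappa z < 1)%R := kappa_itv hz0 hz1.
have LS m : S m `<=` calL mu by move=> t St; exact/hL0/(hSL0 m).
have Ls : calL mu s := hL0 _ hsL0.
have Nfin i : \int[P]_w N i w [set: X i] < +oo.
  by have [-> ] := hNs i _ measurableT.
have Sigma_fin : \esum_(m in [set: M]) (expR (- Delta m))%:E \is a fin_num.
  by rewrite ge0_fin_numE// esum_ge0// => m _; rewrite lee_fin expR_ge0.
rewrite le_min mu_ext_le1 andbT.
rewrite -(fineK Sigma_fin) -EFin_expe -!EFinM.
apply: (mu_ext_exp_left_limit xi0) => xi' /andP[xi'0 xi'xi].
(* The weights of the two models are added to the level, so that the bounds on
   the bad events are summable. *)
pose y2 m m' := (tau * (Num.max (dim m) (dim m') + (Delta m + Delta m' + xi')))%R.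
have level0 m m' : (0 < Delta m + Delta m' + xi')%R.
  by have := hDelta1 m; have := hDelta1 m'; lra.
have y20 m m' : (0 < y2 m m')%R by rewrite mulr_gt0// addr_gt0// lt_max hdim.
pose bad m m' := [set w | z%:E <= ereal_sup
  [set Z mu s (observation N w) tt.1 tt.2
       / w2 mu s tt.1 tt.2 (Num.sqrt (y2 m m')) | tt in S m `*` S m']].
(* Outside the bad events and the null event where some measure is infinite,
   the risk bound at level [xi'] holds for all competitors. *)
apply: (@le_trans _ _ ((P^*)%mu
    (\bigcup_i [set w | ~ (N i w [set: X i] < +oo)] `|`
     \bigcup_m \bigcup_m' bad m m'))); last first.
  apply: (le_trans (outer_measureU2 _ _ _)).
  rewrite -[leRHS]add0e; apply: leeD.
    by have := mu_ext_kernel_infinite Nfin => /eqP; rewrite eq_le => /andP[].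
  apply: mu_ext_model_pairs => //; first exact: ltW.
  move=> m m'; apply: hdev => //; first by rewrite sqrtr_gt0.
  by rewrite sqr_sqrtr// ltW.
apply: le_mu_ext => w Ew; apply: contrapT => /not_orP[fin_w good_w].
have nu_fin i : observation N w i [set: X i] < +oo.
  by apply: contrapT => Nw; apply: fin_w; exists i.
set est := fun l => shat l (observation N w).
have Lest l : calL mu (est l) by have [m _ /LS] := hshatS l w.
have dev := @deviation_bound_of_models _ _ _ _ mu (observation N w) s pen M S
  dim Delta z tau xi' hz0 htau hdim hDelta1 hpen xi'0.
have {}dev l l' : deviation_bound mu (observation N w) s pen z tau xi' (est l) (est l').
  apply: dev; [|exact: hshatS..] => m m' t t' St St'.
  apply: (rZ_le_of_sup nu_fin Ls (@LS m) (@LS m')) => //; first exact: y20.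
  rewrite ltNge; apply/negP => bad_w; apply: good_w.
  by exists m => //; exists m'.
have pen_ge l : (z * tau <= pen (est l))%R.
  exact: (penalty_ge hz0 htau hdim hDelta1 (hshatS l w) (hpen _ (hshatS l w))).
have risk := selected_risk_le nu_fin Ls Lest hz0 kz htau xi'0 pen_ge dev (hlhat w).
have C10 := C1_gt0 kz; have C20 := C2_gt0 hz0 kz.
move: Ew => /=; rewrite -/(est (lhat w)) H2E//.
set I := ereal_inf _.
have I_ge : ((h2 mu s (est (lhat w)) - C2 z * tau * xi') / C1 z)%:E <= I.
  apply: le_ereal_inf_tmp => _ [l _ <-]; rewrite -/(est l) H2E// -EFinD lee_fin.
  by rewrite ler_pdivrMr//; have := risk l; lra.
have CI_ge : (h2 mu s (est (lhat w)) - C2 z * tau * xi')%:E <= (C1 z)%:E * I.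
  rewrite muleC -lee_pdivrMr// -EFinM; exact: I_ge.
apply/negP; rewrite -ltNge; apply: lt_le_trans (leeD2r _ CI_ge).
rewrite -EFinD lte_fin.
have : (C2 z * tau * xi' < C2 z * tau * xi)%R by rewrite ltr_pM2l// mulr_gt0.
lra.
Qed.
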